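(* Let $F_n:=\{(x_i(n),y_i(n)): 1\le i\le k_n\}$, $n\ge1$, be a sequence of subsets of $\mathbb{R}^2$, each consisting of $k_n$ points, where $k_n\to\infty$ as $n\to\infty$, and suppose that $F_n$ converges in $\mathcal{K}_2$ to a bounded (closed) line segment $F\in\mathcal{K}_2$ with slope $m$, where $|m|<\infty$. Write $\bar x_n=\frac1{k_n}\sum_{j=1}^{k_n}x_j(n)$ and $\bar y_n=\frac1{k_n}\sum_{j=1}^{k_n}y_j(n)$. Suppose that there exists $\delta>0$ such that $$p_\delta^n:=\frac{\#\Bigl(\bigl\{(\bar x_n-\delta,\bar x_n+\delta)\times(\bar y_n-\delta,\bar y_n+\delta)\bigr\}\cap F_n\Bigr)}{\#F_n}\ \longrightarrow\ p_\delta\in[0,1)\qquad(n\to\infty).$$ Then $LS(F_n)\to LS(F)=m$ as $n\to\infty$.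
   Context: $\mathcal{K}_2$ is the class of compact subsets of $\mathbb{R}^2$; convergence of nonempty sets in $\mathcal{K}_2$ is convergence in the Hausdorff metric $D(S,T)=\inf\{\delta>0: S\subset T^\delta,\ T\subset S^\delta\}$, with $S^\delta=\{x: d(x,y)<\delta\text{ for some }y\in S\}$ and $d$ the Euclidean distance. $\#A$ is the cardinality of a finite set $A$. For a closed set that is either finite or a closed bounded line segment, $LS(\cdot)$ is the slope of the least squares line through the set: for a finite set of points $(x_i,y_i)$, $i=1,\dots,k$, with means $\bar x,\bar y$, it is $\sum_i(y_i-\bar y)(x_i-\bar x)/\sum_i(x_i-\bar x)^2$ (when the denominator is nonzero), and for a line segment it is the slope of the segment. *)

(* Defs.v *)
From HB Require Import structures.
From mathcomp Require Import all_boot all_order all_algebra.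
From mathcomp Require Import finmap.
From mathcomp Require Import all_classical all_reals all_analysis.

Set Implicit Arguments.
Unset Strict Implicit.
Unset Printing Implicit Defensive.

Import Order.TTheory GRing.Theory Num.Theory.
Import numFieldNormedType.Exports.

Local Open Scope classical_set_scope.
Local Open Scope ring_scope.

(* The library norm on R * R is the max norm, hence an explicit Euclidean
   distance. *)
Definition edist (R : realType) (p q : R * R) : R :=
  Num.sqrt ((p.1 - q.1) ^+ 2 + (p.2 - q.2) ^+ 2).

Definition thicken (R : realType) (S : set (R * R)) (e : R) : set (R * R) :=
  [set x | exists2 y, S y & edist x y < e].

(* Only meaningful for nonempty bounded S and T: otherwise the set below may be
   empty, in which case inf returns 0. *)
Definition hausdorff (R : realType) (S T : set (R * R)) : R :=
  inf [set e | [/\ 0 < e, S `<=` thicken T e & T `<=` thicken S e]].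

Definition segment (R : realType) (a b : R * R) : set (R * R) :=
  [set p | exists2 t : R, 0 <= t <= 1 & p = (1 - t) *: a + t *: b].

(* Slopes take values in \bar R, and a slope that does not exist as a real
   number is +oo; so convergence to a real number entails that the slopes are
   eventually given by the quotient with nonzero denominator. *)
Definition slope (R : realType) (a b : R * R) : \bar R :=
  if a.1 == b.1 then +oo%E else ((b.2 - a.2) / (b.1 - a.1))%:E.

Definition xmean (R : realType) (A : {fset R * R}) : R :=
  (\sum_(p <- A) p.1) / #|` A|%:R.

Definition ymean (R : realType) (A : {fset R * R}) : R :=
  (\sum_(p <- A) p.2) / #|` A|%:R.

Definition LS_fin (R : realType) (A : {fset R * R}) : \bar R :=
  let d := \sum_(p <- A) (p.1 - xmean A) ^+ 2 in
  if d == 0 then +oo%E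
  else ((\sum_(p <- A) (p.2 - ymean A) * (p.1 - xmean A)) / d)%:E.

(* On a set that is neither finite nor a segment the value is the default
   +oo. *)
Definition LS (R : realType) (S : set (R * R)) : \bar R :=
  if `[< finite_set S >] then LS_fin (fset_set S)
  else xget +oo%E [set s | exists a b, S = segment a b /\ s = slope a b].

Definition mean_box (R : realType) (A : {fset R * R}) (delta : R) : set (R * R) :=
  `]xmean A - delta, xmean A + delta[ `*` `]ymean A - delta, ymean A + delta[.

Definition box_proportion (R : realType) (A : {fset R * R}) (delta : R) : R :=
  #|` fset_set (mean_box A delta `&` [set` A])|%:R / #|` A|%:R.

(* Main.v *)
Require Import Defs.
From HB Require Import structures.
From mathcomp Require Import all_boot all_order all_algebra.
From mathcomp Require Import finmap.
From mathcomp Require Import all_classical all_reals all_analysis.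
From mathcomp Require Import ring lra.
Import Order.TTheory GRing.Theory Num.Theory.
Import numFieldNormedType.Exports.
Local Open Scope classical_set_scope.
Local Open Scope ring_scope.

(** Let the segment lie on the line [y = m x + c], and let
    [r = y - (m x + c)] be the residual of a point [(x, y)] of the n-th set
    [A], whose means are [xm], [ym].  If [A] is at Hausdorff distance less than
    [e] from the segment, all residuals are at most [(|m| + 1) e]
    ([thicken_segment_residual]).  Since the deviations [x - xm] sum to zero,
    [sum (y - ym) (x - xm) = m S + sum r (x - xm)] with
    [S = sum (x - xm)^2] ([sum_codev]), so that the error of the least squares
    slope is [(sum r (x - xm)) / S].

    The only danger is a small [S], and the box condition excludes it.  Because
    [A] is close to a line of finite slope, a point at which [|y - ym|] is at
    least [delta] also has [|x - xm|] bounded below; hence every point outside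
    the box satisfies [(|m| + 1) |x - xm| >= delta / 2] ([xdev_out_box]).  A
    proportion of the points bounded away from 0 lies outside the box, so
    [S >= kappa #A] for a fixed [kappa > 0] ([sum_xdev2_ge]).  As
    [|u| <= (1 + u^2) / 2], residuals bounded by [eps] give an error of at most
    [eps (#A + S) / (2 S) <= eps (1 / kappa + 1) / 2] ([LS_fin_near]), which
    tends to 0 with [eps].

    The growth of the cardinalities only serves to make the sets eventually
    nonempty: this makes the means genuine, and without it the infimum
    defining the Hausdorff distance would be a default value. *)

(* The library also has an [edist], with values in the extended reals. *)
Local Notation edist := Defs.edist.

(** * The Hausdorff distance, segments and their slopes *)

Section Segments.
Set Implicit Arguments.
Unset Strict Implicit.

Variable R : realType.
Implicit Types (p q a b : R * R) (S T : set (R * R)).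

Lemma edistC p q : edist p q = edist q p.
Proof. by rewrite /edist -sqrrN opprB -[(p.2 - _) ^+ 2]sqrrN opprB. Qed.

Lemma ler_fst_edist p q : `|p.1 - q.1| <= edist p q.
Proof. by rewrite -sqrtr_sqr ler_wsqrtr// lerDl sqr_ge0. Qed.

Lemma ler_snd_edist p q : `|p.2 - q.2| <= edist p q.
Proof. by rewrite -sqrtr_sqr ler_wsqrtr// lerDr sqr_ge0. Qed.

Lemma edist_ler_sum p q : edist p q <= `|p.1 - q.1| + `|p.2 - q.2|.
Proof.
have h : 0 <= `|p.1 - q.1| + `|p.2 - q.2| by rewrite addr_ge0.
rewrite -[leRHS]ger0_norm// -sqrtr_sqr ler_wsqrtr// [leRHS]sqrrD.
rewrite !real_normK ?num_real//.
by rewrite lerD2r lerDl mulrn_wge0// mulr_ge0.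
Qed.

(** The bound [B] on the distances makes the set of admissible radii nonempty,
    so that its infimum is not a default value. *)
Lemma hausdorff_lt_thicken S T (B e : R) : S !=set0 -> T !=set0 ->
  (forall x y, S x -> T y -> edist x y <= B) ->
  hausdorff S T < e -> S `<=` thicken T e.
Proof.
move=> [x0 Sx0] [y0 Ty0] STB /inf_lt[].
  have B1 : B < `|B| + 1 by rewrite ltr_pwDr// ler_norm.
  exists (`|B| + 1); split; first by rewrite ltr_pwDr.
  - by move=> x Sx; exists y0 => //; exact: le_lt_trans (STB _ _ Sx Ty0) B1.
  - move=> y Ty; exists x0 => //; rewrite edistC.
    exact: le_lt_trans (STB _ _ Sx0 Ty) B1.
move=> d [_ STd _] de x /STd[y Ty xyd]; exists y => //.
exact: lt_trans xyd de.
Qed.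

Lemma segment_left a b : segment a b a.
Proof. by exists 0; rewrite ?lexx ?ler01// subr0 scale1r scale0r addr0. Qed.

Lemma segment_right a b : segment a b b.
Proof. by exists 1; rewrite ?lexx ?ler01// subrr scale1r scale0r add0r. Qed.

Lemma segment_edist_le a b p q : segment a b q ->
  edist p q <= `|p.1| + `|p.2| + (`|a.1| + `|b.1| + `|a.2| + `|b.2|).
Proof.
move=> [t /andP[t0 t1] ->]; apply: (le_trans (edist_ler_sum _ _)) => /=.
have H (u v w : R) : `|u - ((1 - t) * v + t * w)| <= `|u| + `|v| + `|w|.
  rewrite (le_trans (ler_normB _ _))// -addrA lerD2l.
  rewrite (le_trans (ler_normD _ _))// !normrM.
  rewrite (ger0_norm t0) ger0_norm ?subr_ge0//.
  by rewrite lerD// ler_piMl// lerBlDr lerDl.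
have := H p.1 a.1 b.1; have := H p.2 a.2 b.2; rewrite /GRing.scale /=; lra.
Qed.

Lemma slope_fin a b (m : R) : slope a b = m%:E ->
  a.1 != b.1 /\ b.2 - a.2 = m * (b.1 - a.1).
Proof.
rewrite /slope; case: eqVneq => // ab [<-]; split => //.
by rewrite divfK// subr_eq0 eq_sym.
Qed.

Lemma segment_line a b (m : R) p : slope a b = m%:E -> segment a b p ->
  p.2 = m * p.1 + (a.2 - m * a.1).
Proof.
move=> /slope_fin[_ h] [t _ ->] /=; rewrite /GRing.scale /=.
by move/eqP: h; rewrite subr_eq => /eqP ->; ring.
Qed.

Lemma infinite_segment a b : a.1 != b.1 -> infinite_set (segment a b).
Proof.
move=> ab fin_ab.
pose f (n : nat) : R * R := (1 - n.+1%:R^-1) *: a + n.+1%:R^-1 *: b.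
have fE n : (f n).1 = a.1 + n.+1%:R^-1 * (b.1 - a.1).
  by rewrite /f /= /GRing.scale /=; ring.
(* The points of parameter [1 / (n + 1)] are pairwise distinct. *)
apply: infinite_nat; have -> : setT = f @^-1` segment a b.
  apply/esym/seteqP; split => // n _; exists n.+1%:R^-1 => //.
  by rewrite invr_ge0 ler0n/= invf_le1 ?ltr0n// ler1n.
apply: finite_preimage => // i j _ _ /(congr1 fst).
rewrite !fE => /addrI/mulIf; rewrite subr_eq0 eq_sym ab => /(_ isT)/invr_inj/eqP.
by rewrite eqr_nat => /eqP[].
Qed.

(** The slope does not depend on the endpoints chosen to represent the segment:
    [b - a] is a multiple of [d - c]. *)
Lemma segment_slope_unique a b c d (m : R) : slope a b = m%:E ->
  segment a b = segment c d -> slope c d = m%:E.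
Proof.
move=> /slope_fin[ab h] abcd.
have [s _ aE] : segment c d a by rewrite -abcd; exact: segment_left.
have [t _ bE] : segment c d b by rewrite -abcd; exact: segment_right.
have e1 : b.1 - a.1 = (t - s) * (d.1 - c.1).
  by rewrite aE bE /= /GRing.scale /=; ring.
have e2 : b.2 - a.2 = (t - s) * (d.2 - c.2).
  by rewrite aE bE /= /GRing.scale /=; ring.
have : (t - s) * (d.1 - c.1) != 0 by rewrite -e1 subr_eq0 eq_sym.
rewrite mulf_eq0 negb_or => /andP[ts dc].
rewrite /slope eq_sym -subr_eq0 (negbTE dc); congr (_%:E).
have -> : d.2 - c.2 = m * (d.1 - c.1).
  by apply: (mulfI ts); rewrite -e2 h e1; ring.
by rewrite mulfK.
Qed.

Lemma LS_segment a b (m : R) : slope a b = m%:E -> LS (segment a b) = m%:E.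
Proof.
move=> abm; rewrite /LS; case: asboolP => [|_].
  by have [ab _] := slope_fin abm; move/(infinite_segment ab).
apply: xget_unique; first by exists a, b.
by move=> _ [c [d [abcd ->]]]; exact: segment_slope_unique abm abcd.
Qed.
Lemma thicken_segment_residual a b p (m e : R) :
  slope a b = m%:E -> thicken (segment a b) e p ->
  `|p.2 - (m * p.1 + (a.2 - m * a.1))| <= (`|m| + 1) * e.
Proof.
move=> abm [q abq /ltW pqe]; have qE := segment_line abm abq.
have -> : p.2 - (m * p.1 + (a.2 - m * a.1)) = (p.2 - q.2) - m * (p.1 - q.1).
  by rewrite qE; ring.
rewrite (le_trans (ler_normB _ _))// normrM addrC mulrDl mul1r lerD//.
  by rewrite ler_wpM2l// (le_trans (ler_fst_edist _ _)).
by rewrite (le_trans (ler_snd_edist _ _)).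
Qed.

Lemma edist_fset_segment_bounded (A : {fset R * R}) a b : exists B : R,
  forall x y, [set` A] x -> segment a b y -> edist x y <= B.
Proof.
exists (\sum_(p <- A) (`|p.1| + `|p.2|) +
        (`|a.1| + `|b.1| + `|a.2| + `|b.2|)) => x y xA aby.
rewrite (le_trans (segment_edist_le x aby))// lerD2r.
rewrite (big_fsetD1 x)//= lerDl; apply: sumr_ge0 => p _; exact: addr_ge0.
Qed.

End Segments.

(** * Least squares slope of a finite set close to a line *)

Section LeastSquares.
Set Implicit Arguments.
Unset Strict Implicit.

Variables (R : realType) (A : {fset R * R}).

Lemma LS_fset : LS [set` A] = LS_fin A.
Proof.
rewrite /LS; case: asboolP => [_|]; first by rewrite set_fsetK.
by move=> /(_ (finite_fset A)).
Qed.

Lemma card_fset_set_sum (P : set (R * R)) :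
  #|` fset_set (P `&` [set` A])|%:R = \sum_(p <- A) (p \in P)%:R :> R.
Proof.
have -> : fset_set (P `&` [set` A]) = [fset p in A | p \in P]%fset.
  apply/fsetP => p; rewrite in_fset_set; last exact/finite_setIr.
  rewrite in_setI !inE/= andbC; congr (_ && _).
  by apply/idP/idP; rewrite inE.
rewrite card_fset_sum1 natr_sum big_fset/= big_mkcond/=.
by apply: eq_bigr => p _; case: ifP.
Qed.

Hypothesis A0 : (0 < #|` A|)%N.
Let A0R : #|` A|%:R != 0 :> R. Proof. by rewrite pnatr_eq0 -lt0n. Qed.

Lemma sum_const_fset (c : R) : \sum_(p <- A) c = #|` A|%:R * c.
Proof.
rewrite card_fset_sum1 natr_sum mulr_suml.
by apply: eq_bigr => p _; rewrite mul1r.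
Qed.

Lemma sum_xdev_eq0 : \sum_(p <- A) (p.1 - xmean A) = 0.
Proof.
by rewrite sumrB sum_const_fset /xmean mulrC divfK// subrr.
Qed.


(** Any constant [c] may be used, as the deviations sum to zero. *)
Lemma sum_codev (m c : R) :
  \sum_(p <- A) (p.2 - ymean A) * (p.1 - xmean A) =
  m * (\sum_(p <- A) (p.1 - xmean A) ^+ 2) +
  \sum_(p <- A) (p.2 - (m * p.1 + c)) * (p.1 - xmean A).
Proof.
have := congr1 ( *%R (c + m * xmean A - ymean A)) sum_xdev_eq0.
rewrite mulr0 => h; rewrite -[RHS]addr0 -[X in _ = _ + X]h.
rewrite !mulr_sumr -!big_split/=.
by apply: eq_bigr => p _; ring.
Qed.

Lemma mean_residual_le (m c e : R) :
  (forall p, p \in A -> `|p.2 - (m * p.1 + c)| <= e) ->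
  `|ymean A - (m * xmean A + c)| <= e.
Proof.
move=> Ae.
have -> : ymean A - (m * xmean A + c) =
    (\sum_(p <- A) (p.2 - (m * p.1 + c))) / #|` A|%:R.
  rewrite sumrB big_split/= sum_const_fset -mulr_sumr /ymean /xmean.
  by field.
rewrite normrM normfV normr_nat ler_pdivrMr ?ltr0n// mulrC -sum_const_fset.
rewrite (le_trans (ler_norm_sum _ _ _))// big_seq [leRHS]big_seq.
exact: ler_sum.
Qed.

(** Near a line of slope [m], a point that leaves the box vertically has also
    moved horizontally, by at least [delta / (2 (|m| + 1))]. *)
Lemma xdev_out_box (m c e delta : R) p :
  (forall q, q \in A -> `|q.2 - (m * q.1 + c)| <= e) -> e <= delta / 4 ->
  p \in A -> ~ mean_box A delta p ->
  delta / 2 <= (`|m| + 1) * `|p.1 - xmean A|.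
Proof.
move=> Ae ed pA; have := mean_residual_le Ae; have := Ae _ pA.
set x := xmean A; set y := ymean A => re me pbox.
rewrite leNgt; apply/negP => lt.
have d0 : 0 <= delta by have := normr_ge0 (y - (m * x + c)); lra.
have mx0 : 0 <= `|m| * `|p.1 - x| by rewrite mulr_ge0.
have x0 := normr_ge0 (p.1 - x).
apply: pbox; rewrite /mean_box/=; split; rewrite in_itv/= -ltr_distlC.
  by rewrite distrC; lra.
have -> : y - p.2 = (y - (m * x + c)) - (p.2 - (m * p.1 + c)) - m * (p.1 - x).
  by ring.
rewrite (le_lt_trans (ler_normB _ _))// normrM.
have := ler_normB (y - (m * x + c)) (p.2 - (m * p.1 + c)); lra.
Qed.

(** Lower bound on the denominator of the least squares slope: [1 -
    box_proportion A delta] is the proportion of points to which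
    [xdev_out_box] applies. *)
Lemma sum_xdev2_ge (m c e delta : R) :
  (forall q, q \in A -> `|q.2 - (m * q.1 + c)| <= e) -> e <= delta / 4 ->
  (delta / 2) ^+ 2 * (1 - box_proportion A delta) * #|` A|%:R <=
  (`|m| + 1) ^+ 2 * \sum_(p <- A) (p.1 - xmean A) ^+ 2.
Proof.
move=> Ae ed.
have d0 : 0 <= delta.
  by have := le_trans (normr_ge0 _) (mean_residual_le Ae); lra.
rewrite -mulrA mulrBl mul1r /box_proportion divfK// card_fset_set_sum.
rewrite -[X in X - _]mulr1 -sum_const_fset -sumrB !mulr_sumr.
rewrite big_seq [leRHS]big_seq; apply: ler_sum => p pA.
have [pbox|pbox] := boolP (p \in mean_box A delta).
  by rewrite subrr mulr0 mulr_ge0 ?sqr_ge0.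
rewrite subr0 mulr1 -exprMn -[leRHS]real_normK ?num_real// lerXn2r ?nnegrE//.
  by rewrite divr_ge0.
rewrite normrM (@ger0_norm _ (`|m| + 1)) ?addr_ge0//.
by apply: xdev_out_box Ae ed pA _ => /mem_set; rewrite (negbTE pbox).
Qed.

Lemma LS_fin_near (m c e kappa : R) :
  (forall q, q \in A -> `|q.2 - (m * q.1 + c)| <= e) -> 0 < kappa ->
  kappa * #|` A|%:R <= \sum_(p <- A) (p.1 - xmean A) ^+ 2 ->
  exists2 s, LS_fin A = s%:E & `|s - m| <= e * (kappa^-1 + 1) / 2.
Proof.
move=> Ae k0; rewrite /LS_fin (sum_codev m c); set S := (X in _ <= X) => kS.
have S0 : 0 < S by rewrite (lt_le_trans _ kS)// mulr_gt0// ltr0n.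
have e0 : 0 <= e := le_trans (normr_ge0 _) (mean_residual_le Ae).
rewrite gt_eqF//; eexists; first by [].
rewrite mulrDl mulfK ?gt_eqF// addrC addKr normrM normfV (gtr0_norm S0).
rewrite ler_pdivrMr// (le_trans (ler_norm_sum _ _ _))//.
rewrite (@le_trans _ _ (\sum_(p <- A) e * ((1 + (p.1 - xmean A) ^+ 2) / 2)))//.
  rewrite big_seq [leRHS]big_seq; apply: ler_sum => p pA.
  rewrite normrM ler_pM ?Ae// -[(p.1 - _) ^+ 2]real_normK ?num_real//.
  (* [|u| <= (1 + u^2) / 2] *)
  have := sqr_ge0 (`|p.1 - xmean A| - 1); lra.
rewrite -mulr_sumr -mulr_suml big_split/= sum_const_fset mulr1.
rewrite -!mulrA ler_wpM2l//.
have : #|` A|%:R <= S / kappa by rewrite ler_pdivlMr// mulrC.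
rewrite -/S; set k := #|` A|%:R; nra.
Qed.

End LeastSquares.

(** * Convergence of the least squares slopes *)

Theorem proposition5p1 (R : realType) (k : nat -> nat)
    (Fn : nat -> {fset R * R}) (F : set (R * R)) (a b : R * R)
    (m delta p : R)
    (card_Fn : forall n : nat, #|` Fn n| = k n)
    (k_infty : k n @[n --> \oo] --> \oo)
    (F_segment : F = segment a b)
    (F_slope : slope a b = m%:E)
    (Fn_cvg : hausdorff [set` Fn n] F @[n --> \oo] --> (0 : R))
    (delta_gt0 : 0 < delta)
    (p_range : 0 <= p < 1)
    (p_cvg : box_proportion (Fn n) delta @[n --> \oo] --> p) :
  LS [set` Fn n] @[n --> \oo] --> LS F /\ LS F = m%:E.
Proof.
subst F; rewrite (LS_segment F_slope); split => //.
have [_ p1] := andP p_range.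
have M0 : 0 < `|m| + 1 by rewrite ltr_wpDl.
(* Eventually at least the proportion [(1 - p) / 2] of points is outside the
   box, and [kappa] is the resulting lower bound on [S / #A]. *)
pose kappa := (delta / 2) ^+ 2 * ((1 - p) / 2) / (`|m| + 1) ^+ 2.
have kappa0 : 0 < kappa.
  by rewrite divr_gt0 ?mulr_gt0 ?exprn_gt0 ?divr_gt0 ?subr_gt0.
have K0 : 0 < (kappa^-1 + 1) / 2 by rewrite divr_gt0// addr_gt0 ?invr_gt0.
have near_m (eta : R) : 0 < eta -> \forall n \near \oo,
    exists2 s, LS [set` Fn n] = s%:E & `|s - m| <= eta.
  move=> eta0.
  (* [delta / 4] for the bound on [S], the other term for an error of [eta]. *)
  pose eps := Num.min (delta / 4) (eta / ((kappa^-1 + 1) / 2)).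
  have eps0 : 0 < eps by rewrite lt_min; apply/andP; split; exact: divr_gt0.
  have e0 : 0 < eps / (`|m| + 1) by rewrite divr_gt0.
  have box_lt : p < (1 + p) / 2 by lra.
  near=> n.
  have A0 : (0 < #|` Fn n|)%N.
    rewrite card_Fn; near: n; exact: (k_infty _ (nbhs_infty_gt 0)).
  have resid q : q \in Fn n ->
      `|q.2 - (m * q.1 + (a.2 - m * a.1))| <= eps.
    move=> qF; rewrite -[leRHS](divfK (lt0r_neq0 M0)) [leRHS]mulrC.
    apply: (thicken_segment_residual F_slope).
    have [B AB] := edist_fset_segment_bounded (Fn n) a b.
    apply: (hausdorff_lt_thicken _ _ AB) => //.
    - by exists q.
    - by exists a; exact: segment_left.
    - near: n; exact: (cvgr_lt _ Fn_cvg _ e0).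
  have box : box_proportion (Fn n) delta < (1 + p) / 2.
    by near: n; exact: (cvgr_lt _ p_cvg _ box_lt).
  have ed : eps <= delta / 4 by rewrite ge_min lexx.
  have [|s sE sm] := LS_fin_near A0 resid kappa0.
    rewrite mulrAC ler_pdivrMr ?exprn_gt0// [leRHS]mulrC.
    apply: le_trans (sum_xdev2_ge A0 resid ed).
    rewrite ler_wpM2r// ler_wpM2l ?sqr_ge0//; lra.
  exists s; first by rewrite LS_fset.
  apply: (le_trans sm); rewrite -mulrA -ler_pdivlMr//.
  by rewrite ge_min lexx orbT.
apply: cvg_EFin.
  by apply: filterS (near_m 1 ltr01) => n [s -> _].
apply/cvgrPdist_le => eta /near_m; apply: filterS => n [s sE sm].
by rewrite /= sE distrC.
Unshelve. all: by end_near.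
Qed.
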